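(* Let $\lambda=(\lambda_k)_{k\ge 0}$ be a strictly increasing sequence of positive real numbers tending to $\infty$, with $\lambda_{-1}=0$, and let $p=(p_k)_{k\ge 0}$ be a bounded sequence of strictly positive real numbers with $H=\sup_k p_k$ and $M=\max(1,H)$. Let $\ell(\lambda,p)$ be the set of all real sequences $x=(x_k)_{k\ge0}$ with $\sum_{n=0}^{\infty}\left|\frac{1}{\lambda_n}\sum_{k=0}^{n}(\lambda_k-\lambda_{k-1})x_k\right|^{p_n}<\infty$. Then $\ell(\lambda,p)$ is a complete linear metric space with respect to the paranorm $$h(x)=\left(\sum_{n=0}^{\infty}\left|\frac{1}{\lambda_n}\sum_{k=0}^{n}(\lambda_k-\lambda_{k-1})x_k\right|^{p_n}\right)^{1/M}.$$ That is, $\ell(\lambda,p)$ is a real linear space under coordinatewise operations, $h$ is a paranorm on it, and $\ell(\lambda,p)$ is complete for the metric $(x,t)\mapsto h(x-t)$.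
   Context: A paranorm on a real linear space $X$ with zero $\theta$ is a function $h:X\to\mathbb{R}$ that is subadditive, satisfies $h(\theta)=0$ and $h(-x)=h(x)$, and for which scalar multiplication is continuous: if $|\alpha_n-\alpha|\to0$ and $h(x_n-x)\to0$ then $h(\alpha_nx_n-\alpha x)\to0$, for all $\alpha\in\mathbb{R}$ and $x\in X$. *)

(* Defs.v *)
From HB Require Import structures.
From mathcomp Require Import all_boot all_order all_algebra.
From mathcomp Require Import all_classical all_reals all_analysis.
Set Implicit Arguments.
Unset Strict Implicit.
Unset Printing Implicit Defensive.
Import Order.TTheory GRing.Theory Num.Theory.
Import numFieldNormedType.Exports.
Local Open Scope classical_set_scope.
Local Open Scope ring_scope.

(* The space is a subset [X] of an ambient module [V], so [h] and [d] are total
   on [V] and every axiom is relativized to [X]. *)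

Definition paranorm_on (R : realType) (V : lmodType R) (X : set V)
    (h : V -> R) : Prop :=
  [/\ h 0 = 0,
      {in X, forall x, h (- x) = h x},
      {in X &, forall x y, h (x + y) <= h x + h y} &
      forall (a_ : nat -> R) (a : R) (x_ : nat -> V) (x : V),
        (forall n, x_ n \in X) -> x \in X ->
        `|a_ n - a| @[n --> \oo] --> (0 : R) ->
        h (x_ n - x) @[n --> \oo] --> (0 : R) ->
        h (a_ n *: x_ n - a *: x) @[n --> \oo] --> (0 : R)].

Definition metric_on (R : realType) (T : Type) (X : set T) (d : T -> T -> R)
    : Prop :=
  [/\ {in X &, forall x y, 0 <= d x y},
      {in X &, forall x y, d x y = 0 <-> x = y},
      {in X &, forall x y, d x y = d y x} &
      {in X & &, forall x y z, d x z <= d x y + d y z}].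

Definition complete_on (R : realType) (T : Type) (X : set T) (d : T -> T -> R)
    : Prop :=
  forall x_ : nat -> T,
    (forall n, x_ n \in X) ->
    (forall e : R, 0 < e -> exists N : nat, forall m n : nat,
       (N <= m)%N -> (N <= n)%N -> d (x_ m) (x_ n) < e) ->
    exists2 x, x \in X & d (x_ n) x @[n --> \oo] --> (0 : R).

(* The convention lambda_{-1} = 0 is built in at [k = 0]. *)
Definition lambda_diff (R : realType) (lambda : nat -> R) (k : nat) : R :=
  lambda k - (if k is j.+1 then lambda j else 0).

Definition lambda_mean (R : realType) (lambda x : nat -> R) (n : nat) : R :=
  (lambda n)^-1 * \sum_(0 <= k < n.+1) lambda_diff lambda k * x k.

Definition ell_modular (R : realType) (lambda p x : nat -> R) : \bar R :=
  (\sum_(0 <= n <oo) (`|lambda_mean lambda x n| `^ p n)%:E)%E.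

Definition ell (R : realType) (lambda p : nat -> R) : set (nat -> R) :=
  [set x | (ell_modular lambda p x < +oo)%E].

Definition ell_M (R : realType) (p : nat -> R) : R :=
  Num.max 1 (sup (range p)).

(* [fine] is the identity on finite values, hence harmless on [ell lambda p];
   outside of it [ell_h] takes the junk value 0. *)
Definition ell_h (R : realType) (lambda p x : nat -> R) : R :=
  fine (ell_modular lambda p x) `^ (ell_M p)^-1.

(* Main.v *)
Require Import Defs.
From mathcomp Require Import all_boot all_order all_algebra.
From mathcomp Require Import all_classical all_reals all_analysis.
Import Order.TTheory GRing.Theory Num.Theory.
Import numFieldNormedType.Exports.
Local Open Scope classical_set_scope.
Local Open Scope ring_scope.

(* The map [lambda_mean lambda] is a linear bijection of the space of all
   sequences, so everything reduces to the Maddox space of the sequences [y]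
   with [sum_k |y k| `^ p k] finite.  There the triangle inequality is
   Minkowski's inequality, continuity of scalar multiplication is dominated
   convergence for series, and completeness is coordinatewise completeness of
   the reals followed by Fatou's lemma for series. *)

(** * Real powers: concavity and continuity *)

Lemma powR_subadditive {R : realType} (r a b : R) :
  0 < r -> r <= 1 -> 0 <= a -> 0 <= b -> (a + b) `^ r <= a `^ r + b `^ r.
Proof.
move=> r0 r1 a0 b0.
have [ab0|ab_neq0] := eqVneq (a + b) 0.
  by rewrite ab0 powR0 ?gt_eqF// addr_ge0// powR_ge0.
have s0 : 0 < a + b by rewrite lt_def ab_neq0 addr_ge0.
(* As [r <= 1], any [t] in (0, 1] satisfies [t <= t]^ r[. For]t = c / (a + b)[, multiplying by](a +
   b) [^ r] gives [frac]; the fractions of [a] and [b] add up to 1. *)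
have frac c : 0 <= c -> c <= a + b -> c / (a + b) * (a + b) `^ r <= c `^ r.
  move=> c0 cs; have [->|c_neq0] := eqVneq c 0.
    by rewrite !mul0r powR_ge0.
  have cs0 : 0 < c / (a + b) by rewrite divr_gt0// lt_def c_neq0.
  have -> : c `^ r = (c / (a + b)) `^ r * (a + b) `^ r.
    by rewrite -powRM ?(ltW cs0) ?(ltW s0)// divfK.
  rewrite ler_wpM2r ?powR_ge0// ger1_powR// cs0/=.
  by rewrite ler_pdivrMr// mul1r.
apply: le_trans (lerD (frac a a0 _) (frac b b0 _)); rewrite ?lerDl ?lerDr//.
by rewrite -mulrDl -mulrDl divff// mul1r.
Qed.

(** For [a != 0], the power is differentiable at [|a|], hence continuous there. Differentiability
    may fail at 0, so that case is done by hand: [|f t| < e]^ r^-1[forces]|f t| [^ r < e]. *)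
Lemma cvg_norm_powR {R : realType} {T : Type} {F : set_system T}
    {FF : Filter F} (f : T -> R) (a r : R) :
  0 < r -> f @ F --> a -> `|f t| `^ r @[t --> F] --> `|a| `^ r.
Proof.
move=> r0 fa; have [a0|a0] := eqVneq a 0; last first.
  have : {for `|a|, continuous (fun x : R => x `^ r)}.
    apply/differentiable_continuous/derivable1_diffP.
    by apply: derivable_powR; rewrite in_itv/= andbT normr_gt0.
  by move=> /continuous_cvg; apply; exact: cvg_norm.
rewrite {}a0 in fa *; rewrite normr0 powR0 ?gt_eqF//.
apply/cvgr0Pnorm_lt => e e0.
have er0 : 0 < e `^ r^-1 by exact: powR_gt0.
move/cvgr0Pnorm_lt : fa => /(_ _ er0); apply: filterS => t ft.
rewrite ger0_norm ?powR_ge0//.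
rewrite -[ltRHS](@powRr1 _ e) ?ltW// -(mulVf (lt0r_neq0 r0)) powRrM.
by apply: gt0_ltr_powR; rewrite // nnegrE ?powR_ge0.
Qed.

(** * The modular of the Maddox space *)

Definition maddox_modular {R : realType} (p y : nat -> R) : \bar R :=
  (\sum_(0 <= n <oo) (`|y n| `^ p n)%:E)%E.

Lemma maddox_modular_ge0 {R : realType} (p y : nat -> R) :
  (0 <= maddox_modular p y)%E.
Proof. by apply: nneseries_ge0 => n _ _; rewrite lee_fin powR_ge0. Qed.

Lemma maddox_modular0 {R : realType} (p : nat -> R) :
  (forall n, 0 < p n) -> maddox_modular p 0 = 0%E.
Proof.
move=> p0; apply: eseries0 => n _ _.
by rewrite [X in `|X|](_ : _ = 0)// normr0 powR0// gt_eqF.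
Qed.

Lemma maddox_modularN {R : realType} (p y : nat -> R) :
  maddox_modular p (- y) = maddox_modular p y.
Proof.
by apply: eq_eseriesr => n _; rewrite [(- y) n](_ : _ = - y n)// normrN.
Qed.

Lemma le_maddox_modular {R : realType} (p y : nat -> R) (n : nat) :
  ((`|y n| `^ p n)%:E <= maddox_modular p y)%E.
Proof.
have y0 k : (0 <= k)%N -> true -> (0 <= (`|y k| `^ p k)%:E)%E.
  by rewrite lee_fin powR_ge0.
apply: le_trans (nneseries_lim_ge n.+1 y0).
by rewrite big_nat_recr//= leeDr// sume_ge0.
Qed.

(* Since [r k = p k / M <= 1], the modular is the [M]-th power of the
   [l^M]-norm of [|y k| `^ r k], and [t `^ r k] is subadditive. *)
Lemma maddox_modular_subadditive {R : realType} (p : nat -> R) (M : R)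
    (y z : nat -> R) :
  1 <= M -> (forall n, 0 < p n) -> (forall n, p n <= M) ->
  (maddox_modular p (y + z)%R `^ M^-1 <=
   maddox_modular p y `^ M^-1 + maddox_modular p z `^ M^-1)%E.
Proof.
move=> M1 p0 pM; have M0 : 0 < M by exact: lt_le_trans M1.
pose root (u : nat -> R) k := `|u k| `^ (p k / M).
have root_ge0 u k : 0 <= root u k by exact: powR_ge0.
have rootM u k : root u k `^ M = `|u k| `^ p k.
  by rewrite /root -powRrM divfK ?gt_eqF.
have normE u : (maddox_modular p u `^ M^-1)%E =
    Lnorm counting M%:E (EFin \o root u).
  rewrite (Lnorm_counting _ M0); congr poweR; apply: eq_eseriesr => k _ /=.
  by rewrite [`|root u k|]ger0_norm// rootM.
rewrite (normE y) (normE z).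
(* Minkowski's inequality for the counting measure reduces the claim to the termwise bound of
   [root (y + z)] by [root y + root z]. *)
apply: (le_trans _ (@minkowski _ _ _ _ (root y) (root z) _ _ _ M1)) => //.
rewrite (Lnorm_counting _ M0); apply: gt0_ler_poweR.
- by rewrite invr_ge0 ltW.
- by rewrite in_itv/= leey maddox_modular_ge0.
- rewrite in_itv/= leey andbT; apply: nneseries_ge0 => k _ _.
  by rewrite lee_fin powR_ge0.
apply: lee_nneseries => [k _ _|k _]; first by rewrite lee_fin powR_ge0.
rewrite lee_fin -rootM [X in _ <= X `^ _]ger0_norm ?addr_ge0//.
apply: ge0_ler_powR; rewrite ?nnegrE ?addr_ge0// ?(ltW M0)//.
apply: le_trans (powR_subadditive _ _ _ _ _ _ _); rewrite ?divr_gt0//.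
- apply: ge0_ler_powR; rewrite ?nnegrE ?addr_ge0//.
    by rewrite divr_ge0// ltW.
  exact: ler_normD.
- by rewrite ler_pdivrMr// mul1r.
Qed.

Lemma maddox_modularZ {R : realType} (p : nat -> R) (M c : R) (y : nat -> R) :
  (forall n, 0 < p n) -> (forall n, p n <= M) ->
  (maddox_modular p (c *: y) <=
   (Num.max 1 `|c| `^ M)%:E * maddox_modular p y)%E.
Proof.
move=> p0 pM; rewrite -nneseriesZl; last first.
  by move=> k _; rewrite lee_fin powR_ge0.
apply: lee_nneseries => [k _ _|k _]; first by rewrite lee_fin powR_ge0.
rewrite -EFinM lee_fin [X in `|X|](_ : _ = c * y k)// normrM powRM//.
rewrite ler_wpM2r ?powR_ge0//.
apply: (@le_trans _ _ (Num.max 1 `|c| `^ p k)).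
  apply: ge0_ler_powR; rewrite ?nnegrE ?(ltW (p0 k))// ?le_max ?ler01 ?lexx//.
  by rewrite orbT.
by rewrite ler_powR// le_max lexx.
Qed.

Lemma maddox_modular_scale_cvg0 {R : realType} (p : nat -> R) (M : R)
    (b y : nat -> R) :
  (forall n, 0 < p n) -> (forall n, p n <= M) ->
  (maddox_modular p y < +oo)%E -> b @ \oo --> (0 : R) ->
  (maddox_modular p (b n *: y) @[n --> \oo] --> 0)%E.
Proof.
move=> p0 pM yfin b0.
(* [|A| + 1] bounds the convergent sequence [b] and is at least 1, so its [M]-th power bounds all
   its [p k]-th powers. *)
have [C C0 bC] : exists2 C, 0 <= C & forall n k, `|b n| `^ p k <= C.
  have [A [_ /(_ (`|A| + 1))]] : bounded_fun b.
    by apply: cvg_seq_bounded; apply/cvg_ex; exists 0.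
  rewrite (le_lt_trans (ler_norm A)) ?ltrDl// => /(_ isT) bA.
  exists ((`|A| + 1) `^ M) => [|n k]; first exact: powR_ge0.
  apply: (@le_trans _ _ ((`|A| + 1) `^ p k)).
    apply: ge0_ler_powR; rewrite ?nnegrE ?(ltW (p0 k)) ?addr_ge0//.
    exact: bA.
  by rewrite ler_powR// lerDr.
have intE (u : nat -> R) : maddox_modular p u =
    (\int[counting]_k (`|u k| `^ p k)%:E)%E.
  by rewrite ge0_integral_count// => k; rewrite lee_fin powR_ge0.
under eq_fun do rewrite intE.
(* The limit 0 is written as the integral of 0, the form that dominated convergence concludes
   with. *)
have <- := @integral0 _ nat R counting setT.
apply: (@dominated_cvg _ _ _ counting setT _
  (fun n k => (`|(b n *: y) k| `^ p k)%:E) _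
  (fun k => C%:E * (`|y k| `^ p k)%:E)%E) => //.
- move=> k _; apply: cvg_EFin; first by near=> n.
  have /(cvg_norm_powR _ _ _ (p0 k)) : b n * y k @[n --> \oo] --> 0 * y k.
    exact: cvgMl.
  by rewrite mul0r normr0 powR0// gt_eqF.
- apply: integrableZl => //; apply/integrableP; split => //.
  under eq_integral do rewrite gee0_abs ?lee_fin ?powR_ge0//.
  by rewrite -intE.
- move=> n k _ /=; rewrite lee_fin [leLHS]ger0_norm ?powR_ge0//.
  rewrite [X in `|X|](_ : _ = b n * y k)// normrM powRM//.
  by rewrite ler_wpM2r ?powR_ge0.
Unshelve. all: by end_near. Qed.

(** Fatou's argument: a partial sum is a finite sum of continuous functions of the coordinates, so
    the bound [c] on it survives the limit in [m]; the supremum over partial sums comes last. *)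
Lemma maddox_modular_cvg_le {R : realType} (p : nat -> R) (c : R)
    (u : nat -> nat -> R) (v : nat -> R) :
  (forall n, 0 < p n) -> (forall k, u m k @[m --> \oo] --> v k) ->
  (\forall m \near \oo, (maddox_modular p (u m) <= c%:E)%E) ->
  (maddox_modular p v <= c%:E)%E.
Proof.
move=> p0 uv uc; apply: lime_le.
  by apply: is_cvg_nneseries => n _ _; rewrite lee_fin powR_ge0.
apply: nearW => n; rewrite sumEFin lee_fin.
apply: (@cvgr_to_le _ \oo _ _
  (fun m => \sum_(0 <= k < n) `|u m k| `^ p k)).
  apply: cvg_big => [|k _]; first exact: add_continuous.
  exact: cvg_norm_powR.
apply: filterS uc => m; rewrite -lee_fin -sumEFin; apply: le_trans.
by apply: nneseries_lim_ge => k _ _; rewrite lee_fin powR_ge0.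
Qed.

(** * The mean as a linear bijection on sequences *)

Lemma lambda_meanD {R : realType} (lambda x y : nat -> R) :
  lambda_mean lambda (x + y) = lambda_mean lambda x + lambda_mean lambda y.
Proof.
apply/funext => n; rewrite /lambda_mean -[RHS]/(_ * _ + _ * _).
rewrite -mulrDr -big_split/=.
by congr (_ * _); apply: eq_bigr => k _; rewrite -mulrDr.
Qed.

Lemma lambda_meanZ {R : realType} (lambda x : nat -> R) (c : R) :
  lambda_mean lambda (c *: x) = c *: lambda_mean lambda x.
Proof.
apply/funext => n; rewrite /lambda_mean -[RHS]/(c * (_ * _)) mulrCA.
congr (_ * _); rewrite mulr_sumr; apply: eq_bigr => k _.
by rewrite -[(c *: x) k]/(c * x k) mulrCA.
Qed.

Lemma lambda_mean0 {R : realType} (lambda : nat -> R) :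
  lambda_mean lambda 0 = 0.
Proof. by have := lambda_meanZ lambda 0 0; rewrite !scale0r. Qed.

Lemma lambda_meanN {R : realType} (lambda x : nat -> R) :
  lambda_mean lambda (- x) = - lambda_mean lambda x.
Proof. by rewrite -scaleN1r lambda_meanZ scaleN1r. Qed.

(** The inverse of [lambda_mean]: if [y] is the mean of [x], then [lambda n * y n] is the [n]-th
    weighted partial sum, and consecutive differences recover [lambda_diff lambda n * x n]. The 0 at
    [n = 0] matches the convention for index -1. *)
Definition lambda_unmean {R : realType} (lambda y : nat -> R) (n : nat) : R :=
  (lambda_diff lambda n)^-1 *
  (lambda n * y n - if n is j.+1 then lambda j * y j else 0).

Lemma lambda_diff_neq0 {R : realType} (lambda : nat -> R) (k : nat) :
  (forall k, 0 < lambda k) -> {homo lambda : j k / (j < k)%N >-> j < k} ->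
  lambda_diff lambda k != 0.
Proof.
move=> lambda_gt0 lambda_incr; case: k => [|k]; rewrite /lambda_diff.
  by rewrite subr0 gt_eqF.
by rewrite subr_eq0 gt_eqF// lambda_incr.
Qed.

Lemma lambda_unmeanK {R : realType} (lambda : nat -> R) :
  (forall k, 0 < lambda k) -> {homo lambda : j k / (j < k)%N >-> j < k} ->
  cancel (lambda_unmean lambda) (lambda_mean lambda).
Proof.
move=> lambda_gt0 lambda_incr y; apply/funext => n; rewrite /lambda_mean.
(* The weights cancel against the inverses in [lambda_unmean], and the sum telescopes. *)
rewrite [X in _ * X](_ : _ = lambda n * y n); last first.
  elim: n => [|n ih].
    by rewrite big_nat1 mulVKf ?lambda_diff_neq0// subr0.
  by rewrite big_nat_recr//= ih mulVKf ?lambda_diff_neq0// subrKC.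
by rewrite mulKf// gt_eqF.
Qed.

Lemma lambda_meanK {R : realType} (lambda : nat -> R) :
  (forall k, 0 < lambda k) -> {homo lambda : j k / (j < k)%N >-> j < k} ->
  cancel (lambda_mean lambda) (lambda_unmean lambda).
Proof.
move=> lambda_gt0 lambda_incr x; apply/funext => n.
rewrite /lambda_unmean /lambda_mean mulVKf ?gt_eqF//.
case: n => [|n]; first by rewrite big_nat1 subr0 mulKf// lambda_diff_neq0.
rewrite mulVKf ?gt_eqF// big_nat_recr//= addrAC subrr add0r.
by rewrite mulKf// lambda_diff_neq0.
Qed.

(** * Transfer to [ell] and its linear structure *)

Lemma ell_M_ge1 {R : realType} (p : nat -> R) : 1 <= ell_M p.
Proof. by rewrite le_max lexx. Qed.

Lemma ell_M_gt0 {R : realType} (p : nat -> R) : 0 < ell_M p.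
Proof. exact: lt_le_trans (ell_M_ge1 p). Qed.

Lemma le_ell_M {R : realType} (p : nat -> R) (n : nat) :
  has_ubound (range p) -> p n <= ell_M p.
Proof.
move=> pub; rewrite le_max; apply/orP; right.
by apply: ub_le_sup => //; exists n.
Qed.

Lemma ell_modularE {R : realType} (lambda p x : nat -> R) :
  ell_modular lambda p x = maddox_modular p (lambda_mean lambda x).
Proof. by []. Qed.

Lemma ellE {R : realType} (lambda p x : nat -> R) :
  (x \in ell lambda p) = (maddox_modular p (lambda_mean lambda x) < +oo)%E.
Proof. by apply/idP/idP; rewrite inE. Qed.

Lemma ell_h_ge0 {R : realType} (lambda p x : nat -> R) : 0 <= ell_h lambda p x.
Proof. exact: powR_ge0. Qed.

(** Membership makes the modular finite, so [fine] loses nothing. This power form serves scaling and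
    completeness; the root form [ell_hE] serves the triangle inequality. *)
Lemma ell_hM {R : realType} (lambda p x : nat -> R) : x \in ell lambda p ->
  (ell_h lambda p x `^ ell_M p)%:E = maddox_modular p (lambda_mean lambda x).
Proof.
rewrite ellE => xfin; rewrite -powRrM mulVf ?gt_eqF ?ell_M_gt0//.
rewrite powRr1 ?fine_ge0 ?maddox_modular_ge0// fineK//.
by rewrite ge0_fin_numE ?maddox_modular_ge0.
Qed.

Lemma ell_hE {R : realType} (lambda p x : nat -> R) : x \in ell lambda p ->
  ((ell_h lambda p x)%:E =
   maddox_modular p (lambda_mean lambda x) `^ (ell_M p)^-1)%E.
Proof.
rewrite ellE => xfin; rewrite /ell_h -fine_poweR fineK// fin_num_poweR//.
by rewrite ge0_fin_numE ?maddox_modular_ge0.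
Qed.

Lemma ell_add_closed {R : realType} (lambda p x y : nat -> R) :
  (forall k, 0 < p k) -> has_ubound (range p) ->
  x \in ell lambda p -> y \in ell lambda p -> x + y \in ell lambda p.
Proof.
move=> p_gt0 pub xl yl.
have M0 := ell_M_gt0 p.
(* The exponent [(ell_M p)^-1] is nonzero, so finiteness of the root of the modular gives finiteness
   of the modular. *)
rewrite ellE lambda_meanD; apply: (@lty_poweRy _ _ (ell_M p)^-1).
  by rewrite gt_eqF// invr_gt0.
apply: le_lt_trans (maddox_modular_subadditive _ _ _ _ (ell_M_ge1 p) p_gt0 _) _.
  by move=> n; exact: le_ell_M.
by rewrite -!ell_hE// -EFinD ltry.
Qed.

Lemma ell_scale_closed {R : realType} (lambda p x : nat -> R) (c : R) :
  (forall k, 0 < p k) -> has_ubound (range p) ->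
  x \in ell lambda p -> c *: x \in ell lambda p.
Proof.
move=> p_gt0 pub xl; rewrite ellE lambda_meanZ.
apply: le_lt_trans (maddox_modularZ _ (ell_M p) _ _ p_gt0 _) _.
  by move=> n; exact: le_ell_M.
by rewrite -ell_hM// -EFinM ltry.
Qed.

Lemma ell_sub_closed {R : realType} (lambda p x y : nat -> R) :
  (forall k, 0 < p k) -> has_ubound (range p) ->
  x \in ell lambda p -> y \in ell lambda p -> x - y \in ell lambda p.
Proof.
move=> p_gt0 pub xl yl; rewrite -scaleN1r.
exact: (ell_add_closed _ _ _ _ p_gt0 pub xl
  (ell_scale_closed _ _ _ (-1) p_gt0 pub yl)).
Qed.

Lemma ell_submod_closed {R : realType} (lambda p : nat -> R) :
  (forall k, 0 < p k) -> has_ubound (range p) ->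
  GRing.submod_closed (mem (ell lambda p)).
Proof.
move=> p_gt0 pub; split=> [|c x y xl yl].
  by rewrite ellE lambda_mean0 maddox_modular0.
exact: (ell_add_closed _ _ _ _ p_gt0 pub
  (ell_scale_closed _ _ _ c p_gt0 pub xl) yl).
Qed.

(** * The paranorm axioms *)

Lemma ell_h0 {R : realType} (lambda p : nat -> R) :
  (forall k, 0 < p k) -> ell_h lambda p 0 = 0.
Proof.
move=> p_gt0; rewrite /ell_h ell_modularE lambda_mean0.
by rewrite maddox_modular0// powR0// invr_neq0// gt_eqF ?ell_M_gt0.
Qed.

Lemma ell_hN {R : realType} (lambda p x : nat -> R) :
  ell_h lambda p (- x) = ell_h lambda p x.
Proof.
by rewrite /ell_h !ell_modularE lambda_meanN maddox_modularN.
Qed.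

Lemma ell_h_subadditive {R : realType} (lambda p : nat -> R) :
  (forall k, 0 < p k) -> has_ubound (range p) ->
  {in ell lambda p &, forall x y,
    ell_h lambda p (x + y) <= ell_h lambda p x + ell_h lambda p y}.
Proof.
move=> p_gt0 pub x y xl yl.
have addE (a b c : R) (A B C : \bar R) : a%:E = A -> b%:E = B -> c%:E = C ->
    (A <= B + C)%E -> a <= b + c.
  by move=> <- <- <-; rewrite -EFinD lee_fin.
apply: (addE _ _ _ _ _ _
  (ell_hE _ _ _ (ell_add_closed _ _ _ _ p_gt0 pub xl yl))
  (ell_hE _ _ _ xl) (ell_hE _ _ _ yl)).
rewrite lambda_meanD; apply: maddox_modular_subadditive => //.
  exact: ell_M_ge1.
by move=> n; exact: le_ell_M.
Qed.

Lemma ell_hZ_le {R : realType} (lambda p x : nat -> R) (c : R) :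
  (forall k, 0 < p k) -> has_ubound (range p) -> x \in ell lambda p ->
  ell_h lambda p (c *: x) <= Num.max 1 `|c| * ell_h lambda p x.
Proof.
move=> p_gt0 pub xl.
have M0 := ell_M_gt0 p.
(* Transfers a modular bound in the extended reals to the reals, where strict monotonicity of the
   [M]-th power removes the exponent. *)
have scaleE (a b d : R) (A B : \bar R) : 0 <= a -> 0 <= b -> 0 <= d ->
    (a `^ ell_M p)%:E = A -> (b `^ ell_M p)%:E = B ->
    (A <= (d `^ ell_M p)%:E * B)%E -> a <= d * b.
  move=> a0 b0 d0 <- <-; rewrite -EFinM lee_fin -powRM// leNgt => dba.
  rewrite leNgt; apply: contra dba; apply: gt0_ltr_powR => //.
  by rewrite nnegrE mulr_ge0.
apply: (scaleE _ _ _ _ _ (ell_h_ge0 _ _ _) (ell_h_ge0 _ _ _) _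
  (ell_hM _ _ _ (ell_scale_closed _ _ _ c p_gt0 pub xl)) (ell_hM _ _ _ xl)).
  by rewrite le_max ler01.
rewrite lambda_meanZ; apply: maddox_modularZ => // n; exact: le_ell_M.
Qed.

Lemma ell_h_scale_cvg0 {R : realType} (lambda p x b : nat -> R) :
  (forall k, 0 < p k) -> has_ubound (range p) -> x \in ell lambda p ->
  b @ \oo --> (0 : R) -> ell_h lambda p (b n *: x) @[n --> \oo] --> (0 : R).
Proof.
move=> p_gt0 pub xl b0.
have M0 := ell_M_gt0 p.
have xfin : (maddox_modular p (lambda_mean lambda x) < +oo)%E by rewrite -ellE.
have /fine_cvg G0 := maddox_modular_scale_cvg0 _ _ _ _ p_gt0
  (fun n => le_ell_M p n pub) xfin b0.
have Mi0 : 0 < (ell_M p)^-1 by rewrite invr_gt0.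
(* The redundant absolute value gives the shape of [cvg_norm_powR], applied at the limit 0. *)
have -> : (fun n => ell_h lambda p (b n *: x)) = (fun n =>
    `|fine (maddox_modular p (b n *: lambda_mean lambda x))| `^ (ell_M p)^-1).
  apply/funext => n; rewrite /ell_h ell_modularE lambda_meanZ.
  by rewrite ger0_norm// fine_ge0// maddox_modular_ge0.
by have := cvg_norm_powR _ _ _ Mi0 G0; rewrite normr0 powR0 ?gt_eqF//; apply.
Qed.

(** Split [a_ n *: x_ n - a *: x] as [a_ n *: (x_ n - x) + (a_ n - a) *: x]. The first part is
    controlled by [ell_hZ_le] with a bounded factor, the second has a fixed vector and falls under
    [ell_h_scale_cvg0]. *)
Lemma ell_h_scale_continuous {R : realType} (lambda p : nat -> R)
    (a_ : nat -> R) (a : R) (x_ : nat -> nat -> R) (x : nat -> R) :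
  (forall k, 0 < p k) -> has_ubound (range p) ->
  (forall n, x_ n \in ell lambda p) -> x \in ell lambda p ->
  a_ @ \oo --> a ->
  ell_h lambda p (x_ n - x) @[n --> \oo] --> (0 : R) ->
  ell_h lambda p (a_ n *: x_ n - a *: x) @[n --> \oo] --> (0 : R).
Proof.
move=> p_gt0 pub x_l xl aa xx.
have xxl n := ell_sub_closed _ _ _ _ p_gt0 pub (x_l n) xl.
have hx : ell_h lambda p ((a_ n - a) *: x) @[n --> \oo] --> (0 : R).
  by apply: ell_h_scale_cvg0 => //; exact/subr_cvg0.
(* The factor [1 + |a_ n|] majorizes [max(1, |a_ n|)] and has an immediate limit. *)
have : (1 + `|a_ n|) * ell_h lambda p (x_ n - x) +
    ell_h lambda p ((a_ n - a) *: x) @[n --> \oo] --> (0 : R).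
  rewrite -[X in _ --> X](addr0 0) -[X in _ --> X + _](mulr0 (1 + `|a|)).
  apply: cvgD; last exact: hx.
  apply: cvgM; last exact: xx.
  by apply: cvgD; [exact: cvg_cst|exact: cvg_norm].
apply: squeeze_cvgr; last exact: cvg_cst.
apply: nearW => n; rewrite ell_h_ge0/=.
have -> : a_ n *: x_ n - a *: x = a_ n *: (x_ n - x) + (a_ n - a) *: x.
  by rewrite scalerBr scalerBl addrA subrK.
apply: le_trans (ell_h_subadditive _ _ p_gt0 pub _ _ _ _) _.
- exact: ell_scale_closed.
- exact: ell_scale_closed.
rewrite lerD2r; apply: le_trans (ell_hZ_le _ _ _ _ p_gt0 pub (xxl n)) _.
by rewrite ler_wpM2r ?ell_h_ge0// ge_max lerDl lerDr normr_ge0 ler01.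
Qed.

(** * Metric and completeness *)

Lemma ell_h_eq0 {R : realType} (lambda p x : nat -> R) :
  (forall k, 0 < lambda k) -> {homo lambda : j k / (j < k)%N >-> j < k} ->
  x \in ell lambda p -> ell_h lambda p x = 0 -> x = 0.
Proof.
move=> lambda_gt0 lambda_incr xl hx0.
(* By injectivity of the mean it is enough that the mean vanishes; each of its terms is bounded by
   the modular, which is 0. *)
apply: (can_inj (lambda_meanK _ lambda_gt0 lambda_incr)).
rewrite lambda_mean0; apply/funext => n.
have := le_maddox_modular p (lambda_mean lambda x) n.
rewrite -ell_hM// hx0 powR0 ?gt_eqF ?ell_M_gt0//.
rewrite lee_fin => le0; apply/eqP; rewrite -normr_eq0; apply/eqP.
by apply: (@powR_eq0_eq0 _ _ (p n)); apply/eqP; rewrite eq_le le0 powR_ge0.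
Qed.

Lemma ell_metric {R : realType} (lambda p : nat -> R) :
  (forall k, 0 < lambda k) -> {homo lambda : j k / (j < k)%N >-> j < k} ->
  (forall k, 0 < p k) -> has_ubound (range p) ->
  metric_on (ell lambda p) (fun x t => ell_h lambda p (x - t)).
Proof.
move=> lambda_gt0 lambda_incr p_gt0 pub.
have ellB x y := ell_sub_closed lambda p x y p_gt0 pub.
split=> [x y _ _|x y xl yl|x y _ _|x y z xl yl zl].
- exact: ell_h_ge0.
- split=> [/ell_h_eq0 h0|->]; last by rewrite subrr ell_h0.
  by apply/eqP; rewrite -subr_eq0; apply/eqP/h0 => //; exact: ellB.
- by rewrite -ell_hN opprB.
- rewrite -[x - z](subrKA y).
  exact: (ell_h_subadditive _ _ p_gt0 pub _ _
    (ellB _ _ xl yl) (ellB _ _ yl zl)).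
Qed.

Lemma ell_complete {R : realType} (lambda p : nat -> R) :
  (forall k, 0 < lambda k) -> {homo lambda : j k / (j < k)%N >-> j < k} ->
  (forall k, 0 < p k) -> has_ubound (range p) ->
  complete_on (ell lambda p) (fun x t => ell_h lambda p (x - t)).
Proof.
move=> lambda_gt0 lambda_incr p_gt0 pub x_ x_l x_cauchy.
have M0 := ell_M_gt0 p.
have ellB x y := ell_sub_closed lambda p x y p_gt0 pub.
have modular_cauchy e : 0 < e ->
    exists N, forall m n, (N <= m)%N -> (N <= n)%N ->
    (maddox_modular p (lambda_mean lambda (x_ m) - lambda_mean lambda (x_ n))%R
      <= (e `^ ell_M p)%:E)%E.
  move=> /x_cauchy[N xN]; exists N => m n Nm Nn.
  rewrite -lambda_meanN -lambda_meanD.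
  rewrite -(ell_hM _ _ _ (ellB _ _ (x_l m) (x_l n))).
  have hN := ltW (xN _ _ Nm Nn).
  rewrite lee_fin; apply: (ge0_ler_powR (ltW M0) _ _ hN).
    by rewrite nnegrE ell_h_ge0.
  by rewrite nnegrE (le_trans _ hN)// ell_h_ge0.
have coord_cvg k : cvgn (fun n => lambda_mean lambda (x_ n) k).
  apply/cauchy_cvgP/cauchyP => e e0.
  have e10 : 0 < (e / 2) `^ (p k / ell_M p) by rewrite powR_gt0// divr_gt0.
  have [N xN] := modular_cauchy _ e10.
  exists (lambda_mean lambda (x_ N) k), N => // m /= Nm.
  have := le_trans (le_maddox_modular p _ k) (xN N m (leqnn N) Nm).
  rewrite lee_fin -powRrM divfK ?gt_eqF// => le_e.
  rewrite /ball/= ltNge; apply/negP => ge_e; move: le_e; apply/negP.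
  rewrite -ltNge; apply: gt0_ltr_powR; rewrite ?nnegrE ?divr_ge0 ?(ltW e0)//.
  by apply: lt_le_trans ge_e; rewrite ltr_pdivrMr// ltr_pMr// ltr1n.
pose y k := limn (fun n => lambda_mean lambda (x_ n) k).
pose x := lambda_unmean lambda y.
(* Fix [n] and let [m] tend to infinity in the Cauchy estimate, by the Fatou argument: the means of
   [x_ m] converge coordinatewise to [y], the mean of [x]. *)
have modular_le e : 0 < e -> exists N, forall n, (N <= n)%N ->
    (maddox_modular p (lambda_mean lambda (x_ n - x)%R) <= (e `^ ell_M p)%:E)%E.
  move=> /modular_cauchy[N xN]; exists N => n Nn.
  rewrite lambda_meanD lambda_meanN lambda_unmeanK//.
  apply: (maddox_modular_cvg_le _ _
    (fun m => lambda_mean lambda (x_ n) - lambda_mean lambda (x_ m))) => //.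
    by move=> k; apply: cvgB; [exact: cvg_cst|exact: coord_cvg].
  by exists N => // m /= Nm; exact: xN.
(* [x] is [x_ N - (x_ N - x)], and the subtracted term has finite modular by the estimate just
   obtained; the tolerance 1 is arbitrary. *)
have xl : x \in ell lambda p.
  have [N xN] := modular_le 1 ltr01.
  rewrite -(subKr (x_ N) x); apply: (ellB _ _ (x_l N)).
  by rewrite ellE (le_lt_trans (xN N (leqnn N)))// ltry.
exists x => //; apply/cvgr0Pnorm_le => e e0.
have [N xN] := modular_le e e0.
exists N => // n /= Nn; rewrite ger0_norm ?ell_h_ge0// leNgt.
apply/negP => /(gt0_ltr_powR M0).
rewrite !nnegrE ell_h_ge0 (ltW e0) => /(_ isT isT); apply/negP.
rewrite -leNgt -lee_fin (ell_hM _ _ _ (ellB _ _ (x_l n) xl)); exact: xN.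
Qed.

Theorem theorem1 (R : realType) (lambda p : nat -> R)
    (lambda_gt0 : forall k, 0 < lambda k)
    (lambda_incr : {homo lambda : j k / (j < k)%N >-> j < k})
    (lambda_pinfty : lambda k @[k --> \oo] --> +oo)
    (p_gt0 : forall k, 0 < p k)
    (p_bounded : has_ubound (range p)) :
  [/\ GRing.submod_closed (mem (ell lambda p)),
      paranorm_on (ell lambda p) (ell_h lambda p),
      metric_on (ell lambda p) (fun x t => ell_h lambda p (x - t)) &
      complete_on (ell lambda p) (fun x t => ell_h lambda p (x - t))].
Proof.
split; [exact: ell_submod_closed| |exact: ell_metric|exact: ell_complete].
split; [exact: ell_h0|by move=> x _; exact: ell_hN|exact: ell_h_subadditive|].
move=> a_ a x_ x x_l xl /norm_cvg0P/subr_cvg0 aa.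
exact: ell_h_scale_continuous.
Qed.
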